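(* Let $b\in\mathbb{R}$. Almost surely, the level set $\mathcal{L}_\omega(b):=\{t\in[0,\infty)\mid\omega(t)=b\}$ has no isolated points in $[0,\infty)$; that is, the set of $\omega\in\Omega$ for which $\mathcal{L}_\omega(b)$ has an isolated point has upper probability $\overline{\mathbb{P}}$ equal to $0$.
   Context: Let $\Omega$ be the set of all continuous functions $\omega:[0,\infty)\to\mathbb{R}$. For $t\in[0,\infty)$, $\mathcal{F}_t$ is the smallest $\sigma$-algebra on $\Omega$ making all functions $\omega\mapsto\omega(s)$, $s\in[0,t]$, measurable, and $\mathcal{F}_\infty:=\sigma(\cup_{t\in[0,\infty)}\mathcal{F}_t)$. Stopping times $\tau:\Omega\to[0,\infty]$ w.r. to $(\mathcal{F}_t)$ and the $\sigma$-algebras $\mathcal{F}_\tau$ are defined as usual. ''Positive'' means $\ge0$. An elementary trading strategy $G$ consists of (a) stopping times $\tau_1\le\tau_2\le\cdots$ with $\lim_{n\to\infty}\tau_n(\omega)=\infty$ for each $\omega\in\Omega$ (the value $\infty$ is allowed), and (b) for each $n=1,2,\ldots$, a bounded $\mathcal{F}_{\tau_n}$-measurable function $h_n:\Omega\to\mathbb{R}$. Given $G$ and an initial capital $c\in\mathbb{R}$, the elementary capital process is $$\mathcal{K}^{G,c}_t(\omega):=c+\sum_{n=1}^\infty h_n(\omega)\bigl(\omega(\tau_{n+1}(\omega)\wedge t)-\omega(\tau_n(\omega)\wedge t)\bigr),\quad t\in[0,\infty).$$ A positive capital process is any process $S$ of the form $S_t(\omega)=\sum_{n=1}^\infty\mathcal{K}^{G_n,c_n}_t(\omega)\in[0,\infty]$,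 where each elementary capital process $\mathcal{K}^{G_n,c_n}$ is positive (for all $t$ and $\omega$) and $\sum_{n=1}^\infty c_n$ converges; $S_0=\sum_n c_n$ does not depend on $\omega$. The upper probability of $E\subseteq\Omega$ is $\overline{\mathbb{P}}(E):=\inf\{S_0 \mid \forall\omega\in\Omega:\ \liminf_{t\to\infty}S_t(\omega)\ge\mathbb{I}_E(\omega)\}$, where $S$ ranges over the positive capital processes and $\mathbb{I}_E$ is the indicator of $E$. A property of $\omega$ holds almost surely if the set of $\omega\in\Omega$ where it fails has upper probability $0$. *)

(* Defs.v *)
(* MathComp-Analysis *)
From HB Require Import structures.
From mathcomp Require Import all_boot all_order all_algebra.
From mathcomp Require Import all_classical all_reals all_analysis.

Set Implicit Arguments.
Unset Strict Implicit.
Unset Printing Implicit Defensive.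

Import Order.TTheory GRing.Theory Num.Theory.
Import numFieldNormedType.Exports.

Local Open Scope classical_set_scope.
Local Open Scope ring_scope.

(* A continuous function [0, oo) -> R is encoded as a function on R that is
   continuous within [0, oo); pinning its values on the negative axis to 0
   makes the encoding one-to-one. *)
Record cpath (R : realType) : Type := CPath {
  path_fun :> R -> R ;
  path_continuous : {within `[0, +oo[, continuous path_fun} ;
  path_neg : forall t : R, t < 0 -> path_fun t = 0 }.

Section Filtration.
Context {R : realType}.
Implicit Types (t : R) (tau : cpath R -> \bar R).

Definition path_filtration t : set_system (cpath R) :=
  <<s \bigcup_(s in `[0, t])
        preimage_set_system setT (fun w : cpath R => w s) measurable >>.

Definition path_filtration_oo : set_system (cpath R) :=
  <<s \bigcup_(t in `[0, +oo[) path_filtration t >>.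

Definition stopping_time tau : Prop :=
  (forall w, (0 <= tau w)%E) /\
  (forall t, 0 <= t -> path_filtration t [set w | (tau w <= t%:E)%E]).

Definition stopped_sigma_algebra tau : set_system (cpath R) :=
  [set A | path_filtration_oo A /\
    forall t, 0 <= t -> path_filtration t (A `&` [set w | (tau w <= t%:E)%E])].

End Filtration.

(* Sequences are indexed from 0: [trade_time G n] and [position G n] are
   tau_(n+1) and h_(n+1) of the usual 1-based notation. *)
Record elementary_strategy (R : realType) : Type := ElementaryStrategy {
  trade_time : nat -> cpath R -> \bar R ;
  position : nat -> cpath R -> R ;
  trade_time_stopping : forall n, stopping_time (trade_time n) ;
  trade_time_le : forall n w, (trade_time n w <= trade_time n.+1 w)%E ;
  trade_time_cvg : forall w, trade_time n w @[n --> \oo] --> +oo%E ;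
  position_bounded : forall n, exists C : R, forall w, `|position n w| <= C ;
  position_measurable : forall n (B : set R), measurable B ->
    stopped_sigma_algebra (trade_time n) (position n @^-1` B) }.

Section UpperProbability.
Context {R : realType}.
Implicit Types (G : elementary_strategy R) (c t : R) (w : cpath R).
Implicit Types (tau : cpath R -> \bar R) (S : R -> cpath R -> \bar R).

Definition stopped_path tau t w : R := w (fine (mine (tau w) t%:E)).

(* For fixed [t] and [w] only finitely many terms of the series are nonzero,
   because the trading times tend to +oo. *)
Definition elementary_capital G c t w : R :=
  c + limn (series (fun n => position G n w *
    (stopped_path (trade_time G n.+1) t w - stopped_path (trade_time G n) t w))).

Definition positive_capital_process S : Prop :=
  exists (G : nat -> elementary_strategy R) (c : nat -> R),
    [/\ forall n t w, 0 <= t -> 0 <= elementary_capital (G n) (c n) t w,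
        cvgn (series c)
      & forall t w, 0 <= t ->
          S t w = (\sum_(0 <= n <oo) (elementary_capital (G n) (c n) t w)%:E)%E].

Definition upper_probability (E : set (cpath R)) : \bar R :=
  ereal_inf [set x : \bar R | exists S,
    [/\ positive_capital_process S,
        forall w, S 0 w = x
      & forall w, ((\1_E w)%:E <= limf_einf (S ^~ w) (pinfty_nbhs R))%E]].

Definition almost_surely (P : cpath R -> Prop) : Prop :=
  upper_probability [set w | ~ P w] = 0%E.

Definition level_set w (b : R) : set R := [set t | 0 <= t /\ w t = b].

End UpperProbability.

(* Main.v *)
(* An isolated point t of the level set is the first visit to b after some
   rational time p, and right after t the path stays on one side of b until it
   reaches some b + 1/h with h rational. For fixed p and h, start with capital
   k > 0, buy h units at that first visit and sell as soon as the gain is -k or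
   1. The capital stays nonnegative, and it ends at 1 + k on every path having an
   isolated point of type (p, h). As k > 0 is arbitrary and the pairs (p, h) are
   countably many, summing these strategies with capitals e/2^(n+1) gives the
   upper bound e. *)
Require Import Defs.
From HB Require Import structures.
From mathcomp Require Import all_boot all_order all_algebra.
From mathcomp Require Import all_classical all_reals all_analysis.
From mathcomp Require Import lra.
Import Order.TTheory GRing.Theory Num.Theory.
Import numFieldNormedType.Exports.
Local Open Scope classical_set_scope.
Local Open Scope ring_scope.
Set Implicit Arguments.
Unset Strict Implicit.
Unset Printing Implicit Defensive.

(** * Continuous paths, extended to the whole line *)

Section Paths.
Context {R : realType}.
Implicit Types w : cpath R.

(** [Num.max 0] is continuous with values in [0, +oo), where [w] is continuous. Freezing the path
    before time 0 lets results on continuous functions of the whole line apply to it. *)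
Lemma continuous_path_maxr w : continuous (fun s : R => w (Num.max 0 s)).
Proof.
move=> s; have /subspace_continuousP cw := @path_continuous _ w.
have max0 : `[0, +oo[%classic (Num.max 0 s : R).
  by rewrite /= in_itv /= andbT le_max lexx.
have cmax : {for s, continuous (fun x : R => Num.max 0 x)}.
  by apply: (@continuous_max _ _ (cst 0) id) => //; exact: cvg_cst.
apply: (@cvg_trans _ (w x @[x --> within `[0, +oo[ (nbhs (Num.max 0 s))]));
  last exact: cw.
move=> P nP; have : \forall x \near s,
    `[0, +oo[%classic (Num.max 0 x) -> P (w (Num.max 0 x)).
  exact: (cmax _ nP).
apply: filterS => x /=; apply.
by rewrite in_itv /= andbT le_max lexx.
Qed.

Lemma continuous_comp_path_maxr (f : R -> R) w : continuous f ->
  continuous (fun s : R => f (w (Num.max 0 s))).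
Proof.
move=> cf s; apply: (@continuous_comp _ _ _ (fun s : R => w (Num.max 0 s)) f).
  exact: continuous_path_maxr.
exact: cf.
Qed.

Lemma path_IVT (f : R -> R) w (x y v : R) : continuous f -> 0 <= x <= y ->
  Num.min (f (w x)) (f (w y)) <= v <= Num.max (f (w x)) (f (w y)) ->
  exists2 u, x <= u <= y & f (w u) = v.
Proof.
move=> cf /andP[x0 xy] vxy.
have cfw := continuous_subspaceT (@continuous_comp_path_maxr f w cf).
have [|u] := @IVT _ _ x y v xy (cfw _).
  by rewrite (max_r x0) (max_r (le_trans x0 xy)).
rewrite in_itv /= => xuy; rewrite max_r => [<-|]; first by exists u.
by case/andP: xuy => /(le_trans x0).
Qed.

Lemma zero_path_continuous :
  {within `[0, +oo[, continuous (fun _ : R => 0 : R)}.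
Proof. by apply: continuous_subspaceT => x; exact: cvg_cst. Qed.

(** Makes [cpath R] a pointed type; [point] later stands for an arbitrary path in quantities that
    are the same for all paths. *)
Definition zero_path : cpath R := CPath zero_path_continuous (fun _ _ => erefl).

End Paths.

HB.instance Definition _ (R : realType) := gen_eqMixin (cpath R).
HB.instance Definition _ (R : realType) := gen_choiceMixin (cpath R).
HB.instance Definition _ (R : realType) := isPointed.Build (cpath R) zero_path.

(** * Ordered zeros of two functions, tested at rational points *)

Lemma rat_approx (R : realType) (P : set R) (x : R) :
  nbhs x P -> exists q : rat, P (ratr q).
Proof.
move=> Px; have P0 : P^° !=set0 by exists x.
have [y [Py [q _ qy]]] := dense_rat P0 (@open_interior _ P).
by exists q; rewrite qy; exact: interior_subset Py.
Qed.

Section OrderedZeros.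
Context {R : realType}.
Implicit Types (f g : R -> R) (p t x : R).

(** For [p <= t], the continuous retraction of the line onto [p, t]; it carries rational times into
    a segment whose ends may be irrational. *)
Definition clamp p t x : R := Num.max p (Num.min t x).

Lemma clamp_bounds p t x : p <= t -> p <= clamp p t x <= t.
Proof. by move=> pt; rewrite /clamp le_max lexx /= ge_max pt ge_min lexx. Qed.

Lemma clamp_id p t x : p <= x <= t -> clamp p t x = x.
Proof. by move=> /andP[px xt]; rewrite /clamp min_r // max_r. Qed.

Lemma clamp_continuous (T : topologicalType) p (f g : T -> R) (x : T) :
  {for x, continuous f} -> {for x, continuous g} ->
  {for x, continuous (fun y => clamp p (f y) (g y))}.
Proof.
move=> cf cg; apply: (@continuous_max _ _ (cst p) (f \min g)); first exact: cvg_cst.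
exact: continuous_min.
Qed.

(** Density of the rationals gives one direction, compactness the other. An existence over
    uncountably many pairs of times becomes countably many conditions, which is what measurability
    calls for. *)
Lemma zero_pairP p t f g : p <= t -> continuous f -> continuous g ->
    (forall x, 0 <= f x) -> (forall x, 0 <= g x) ->
  (exists r s, [/\ p <= r, r <= s, s <= t, f r = 0 & g s = 0]) <->
  forall n, exists q q' : rat,
    f (clamp p (clamp p t (ratr q')) (ratr q)) < n.+1%:R^-1 /\
    g (clamp p t (ratr q')) < n.+1%:R^-1.
Proof.
move=> pt cf cg f0 g0.
pose c2 (z : R * R) := clamp p t z.2.
pose c1 (z : R * R) := clamp p (c2 z) z.1.
have cc2 z : {for z, continuous c2}.
  by apply: (@clamp_continuous _ _ (cst t) snd); [exact: cvg_cst | exact: cvg_snd].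
have cc1 z : {for z, continuous c1}.
  by apply: (@clamp_continuous _ _ c2 fst) => //; exact: cvg_fst.
have cfc z : {for z, continuous (f \o c1)}.
  by apply: continuous_comp => //; exact: cf.
have cgc z : {for z, continuous (g \o c2)}.
  by apply: continuous_comp => //; exact: cg.
split=> [[r [s [pr rs st fr gs]]] n|approx].
  have n0 : 0 < n.+1%:R^-1 :> R by rewrite invr_gt0.
  have ps : p <= s <= t by rewrite (le_trans pr rs) st.
  have c2E : c2 (r, s) = s by rewrite /c2 clamp_id.
  have c1E : c1 (r, s) = r by rewrite /c1 c2E clamp_id //= pr rs.
  have small (h : R * R -> R) : {for (r, s), continuous h} -> h (r, s) = 0 ->
      \forall z \near (r, s), h z < n.+1%:R^-1.
    by move=> ch h0; apply: (cvgr_lt _ ch); rewrite h0.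
  have sf := small _ (cfc (r, s)) _; have sg := small _ (cgc (r, s)) _.
  have [||[U V] [/= rU sV] UV] := filterI (sf _) (sg _).
    by rewrite /= c1E.
    by rewrite /= c2E.
  have [q Uq] := rat_approx rU; have [q' Vq'] := rat_approx sV.
  by exists q, q'; have [] := UV (ratr q, ratr q') (conj Uq Vq').
(* The clamped functions sweep exactly the triangle [p <= r <= s <= t], on which
   [f + g] attains its minimum. *)
pose F := (f \o c1) \+ (g \o c2).
have [||| z0 z0K zmin] := @compact_EVT_min _ R F (`[p, t] `*` `[p, t]).
- by exists (p, p); rewrite /= in_itv /= lexx pt.
- by apply: compact_setX; exact: segment_compact.
- by apply: continuous_subspaceT => z; apply: cvgD; [exact: cfc | exact: cgc].
have F0 z : 0 <= F z by rewrite addr_ge0 //; [exact: f0 | exact: g0].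
have [Fz0|Fz0] := eqVneq (F z0) 0.
  move/eqP: Fz0; rewrite paddr_eq0 ?f0 ?g0 // => /andP[/eqP fz /eqP gz].
  have /andP[p2 t2] := clamp_bounds z0.2 pt.
  have /andP[p1 t1] := clamp_bounds z0.1 p2.
  by exists (c1 z0), (c2 z0).
have {F0}Fz0 : 0 < F z0 by rewrite lt_neqAle eq_sym Fz0 F0.
(* With 1/(n+1) below half the minimum, the two approximate zeros add up to less than the minimum, a
   contradiction. *)
have /= [n _ /(_ n (leqnn n)) nF] :=
  near_infty_natSinv_lt (PosNum (divr_gt0 Fz0 (ltr0Sn R 1))).
have [q [q' [fq gq]]] := approx n.
set s := clamp p t (ratr q') in fq gq; set r := clamp p s (ratr q) in fq.
have sb : p <= s <= t by exact: clamp_bounds.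
have rb : p <= r <= s by apply: clamp_bounds; case/andP: sb.
have : F z0 <= F (r, s).
  apply: zmin; rewrite inE /= !in_itv /=; split=> //.
  by case/andP: rb => -> /le_trans; apply; case/andP: sb.
have -> : F (r, s) = f r + g s.
  by rewrite /F /= /c1 /c2 /= (clamp_id sb) (clamp_id rb).
move=> /le_lt_trans /(_ (ltrD fq gq)) /lt_trans.
by move=> /(_ _ (ltrD nF nF)); rewrite /= -splitr ltxx.
Qed.

End OrderedZeros.

(** * First times of closed sets *)

Section FirstTime.
Context {R : realType}.
Implicit Types (A : set R) (s t : R).

Definition first_time A : \bar R := ereal_inf (EFin @` A).

Lemma first_time_lbound A s : A s -> (first_time A <= s%:E)%E.
Proof. by move=> As; apply: ereal_inf_lbound; exists s. Qed.

Lemma first_time_ge A (x : \bar R) :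
  (forall s, A s -> (x <= s%:E)%E) -> (x <= first_time A)%E.
Proof. by move=> xA; apply: le_ereal_inf_tmp => _ [s As <-]; exact: xA. Qed.

(** If the closed set [A] has no point at or before [t], a ball of some radius [d] around [t] misses
    it, so the infimum is at least [t + d]. *)
Lemma first_timeP A t : closed A ->
  (first_time A <= t%:E)%E <-> exists2 s, A s & s <= t.
Proof.
move=> cA; split=> [At|[s As st]]; last first.
  by apply: le_trans (first_time_lbound As) _; rewrite lee_fin.
apply: contrapT => noA.
have nAt : ~ A t by move=> ?; apply: noA; exists t.
have : nbhs t (~` A) by apply: open_nbhs_nbhs; split=> //; exact: closed_openC.
move=> /nbhs_ballP[d /= d0 dA].
suff : ((t + d)%:E <= t%:E)%E by rewrite lee_fin; lra.
apply: le_trans At; apply: first_time_ge => s As; rewrite lee_fin leNgt.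
apply/negP => std; have [st|ts] := leP s t; first by apply: noA; exists s.
by apply: (dA s) => //; rewrite /ball /= distrC ger0_norm; lra.
Qed.

Lemma first_time_mem A t : closed A -> first_time A = t%:E -> A t.
Proof.
move=> cA At; have [|s As st] := (first_timeP t cA).1; first by rewrite At.
suff -> : t = s by [].
by apply/le_anti; rewrite st -lee_fin -At first_time_lbound.
Qed.

Lemma closed_ereal_le_EFin (x : \bar R) : closed [set s | (x <= s%:E)%E].
Proof.
case: x => [r| |].
- rewrite (_ : [set s | _] = [set s | r <= s]); first exact: closed_ge.
  by apply/seteqP; split=> s /=; rewrite lee_fin.
- rewrite (_ : [set s | _] = set0); first exact: closed0.
  by apply/seteqP; split=> s //=; rewrite leye_eq.
- rewrite (_ : [set s | _] = setT); first exact: closedT.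
  by apply/seteqP; split=> s //= _; rewrite leNye.
Qed.

End FirstTime.

(** * Hitting times are stopping times *)

Section HittingTimes.
Context {R : realType}.
Implicit Types (w : cpath R) (f g : R -> R) (p s t : R).

(** One formula for both trading times: [g = cst 0] yields the first zero of [f] after [p], and
    another [g] the first zero of [g] from then on. *)
Definition hit_set p f g w : set R :=
  [set s | exists r, [/\ p <= r, r <= s, f (w r) = 0 & g (w s) = 0]].

Definition hit_time p f g w : \bar R := first_time (hit_set p f g w).

Lemma closed_path_zeros p f w : 0 <= p -> continuous f ->
  closed [set s | p <= s /\ f (w s) = 0].
Proof.
move=> p0 cf.
rewrite (_ : [set s | _] = [set s | p <= s] `&`
    (fun s => f (w (Num.max 0 s))) @^-1` [set y | y = 0]).
  apply: closedI; first exact: closed_ge.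
  apply: preimage_closed; last exact: closed_eq.
  by move=> s _; exact: continuous_comp_path_maxr.
by apply/seteqP; split=> s /= [ps]; rewrite (max_r (le_trans p0 ps)).
Qed.

(** A zero of [f] in [p, s] exists exactly when the first zero after [p] is at most [s]; this
    removes [r] and leaves an intersection of two closed sets. *)
Lemma closed_hit_set p f g w : 0 <= p -> continuous f -> continuous g ->
  closed (hit_set p f g w).
Proof.
move=> p0 cf cg; pose Z := [set r | p <= r /\ f (w r) = 0].
have cZ : closed Z by exact: closed_path_zeros.
rewrite (_ : hit_set _ _ _ _ =
    [set s | (first_time Z <= s%:E)%E] `&` [set s | p <= s /\ g (w s) = 0]).
  by apply: closedI; [exact: closed_ereal_le_EFin | exact: closed_path_zeros].
apply/seteqP; split=> s /=.
  move=> [r [pr rs fr gs]]; split; last by split=> //; exact: le_trans rs.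
  by apply/(first_timeP _ cZ); exists r.
by move=> [/(first_timeP _ cZ)[r [pr fr] rs] [ps gs]]; exists r.
Qed.

Lemma path_filtration_eval t s (B : set R) : 0 <= s <= t -> open B ->
  path_filtration t [set w | B (w s)].
Proof.
move=> st oB; apply: sub_sigma_algebra; exists s; first by rewrite /= in_itv.
by exists B; [exact: measurable_realfun.open_measurable | rewrite setTI].
Qed.

(** The hit set being closed, the time is at most [t] exactly when ordered zeros exist in [p, t]. By
    [zero_pairP] this is a countable combination of conditions on path values at fixed times in
    [p, t]. *)
Lemma hit_time_stopping p f g : 0 <= p -> continuous f -> continuous g ->
  (forall x, 0 <= f x) -> (forall x, 0 <= g x) ->
  stopping_time (hit_time p f g).
Proof.
move=> p0 cf cg f0 g0; split=> [w|t t0].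
  apply: first_time_ge => s [r [pr rs _ _]].
  by rewrite lee_fin (le_trans p0) // (le_trans pr).
have [pt|tp] := leP p t; last first.
  rewrite (_ : [set w | _] = set0); first exact: sigma_algebra0.
  apply/seteqP; split=> w //= /(first_timeP _ (closed_hit_set p0 cf cg)).
  by move=> [s [r [pr rs _ _]] st]; move: pr rs st tp; lra.
pose c2 (q' : rat) := clamp p t (ratr q' : R).
pose c1 (q q' : rat) := clamp p (c2 q') (ratr q : R).
rewrite (_ : [set w : cpath R | _] = \bigcap_n \bigcup_q \bigcup_q'
    ([set w : cpath R | f (w (c1 q q')) < n.+1%:R^-1] `&`
     [set w : cpath R | g (w (c2 q')) < n.+1%:R^-1])); last first.
  (* [zero_pairP] asks for continuity on the whole line; [ext] provides it and agrees with the path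
     from [p] on. *)
  pose ext (h : R -> R) w s := h (w (Num.max 0 s)).
  have cext h w : continuous h -> continuous (ext h w).
    exact: continuous_comp_path_maxr.
  have extE h w s : p <= s -> ext h w s = h (w s).
    by move=> ps; rewrite /ext (max_r (le_trans p0 ps)).
  have Q w := zero_pairP pt (cext f w cf) (cext g w cg) (fun=> f0 _) (fun=> g0 _).
  have c12 q q' : p <= c1 q q' /\ p <= c2 q'.
    have /andP[p2 t2] := clamp_bounds (ratr q') pt.
    by have /andP[] := clamp_bounds (ratr q) p2.
  apply/seteqP; split=> w /=.
    move=> /(first_timeP _ (closed_hit_set p0 cf cg))[s [r [pr rs fr gs]] st].
    move=> n _; have [|q [q' [fq gq]]] := (Q w).1 _ n.
      by exists r, s; split; rewrite ?extE //; exact: le_trans rs.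
    exists q => //; exists q' => //; have [p1 p2] := c12 q q'.
    by move: fq gq; rewrite !extE.
  move=> wn; apply/(first_timeP _ (closed_hit_set p0 cf cg)).
  have [|r [s [pr rs st]]] := (Q w).2.
    move=> n; have [q _ [q' _ [fq gq]]] := wn n I; exists q, q'.
    by have [p1 p2] := c12 q q'; rewrite !extE.
  rewrite !extE // ?(le_trans pr rs) // => fr gs.
  by exists s => //; exists r.
have opn (h : R -> R) (u : R) : continuous h -> open [set x | h x < u].
  by move=> ch; apply: (open_comp _ (@open_lt _ u)) => x _; exact: ch.
pose T := g_sigma_algebraType (\bigcup_(s in `[0, t])
  preimage_set_system setT (fun w : cpath R => w s) measurable).
suff : measurable (\bigcap_n \bigcup_q \bigcup_q'
    ([set w : cpath R | f (w (c1 q q')) < n.+1%:R^-1] `&`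
     [set w : cpath R | g (w (c2 q')) < n.+1%:R^-1]) : set T) by [].
apply: bigcapT_measurable => n; apply: bigcupT_measurable_rat => q.
apply: bigcupT_measurable_rat => q'.
have /andP[p2 t2] := clamp_bounds (ratr q') pt.
have /andP[p1 t1] := clamp_bounds (ratr q) p2.
apply: measurableI.
  apply: (@path_filtration_eval _ _ [set x | f x < n.+1%:R^-1]); last exact: opn.
  by rewrite (le_trans p0 p1) (le_trans t1 t2).
apply: (@path_filtration_eval _ _ [set x | g x < n.+1%:R^-1]); last exact: opn.
by rewrite (le_trans p0 p2).
Qed.

End HittingTimes.

(** * The strategy that bets on one crossing *)

Section CrossingStrategy.
Context {R : realType}.
Implicit Types (w : cpath R) (p b h k t x : R).

(** Profit on [h] units bought at price [b] when the price is [x]; a negative [h] bets on a move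
    below [b]. *)
Definition gain b h x : R := h * (x - b).

(** For [k > 0] it is positive exactly while the gain lies strictly between [- k] and 1, so leaving
    that interval is a zero of a nonnegative continuous function. *)
Definition exit_gap b h k x : R := Num.max 0 ((gain b h x + k) * (1 - gain b h x)).

(* Buy [h] units at the first visit to [b] after time [p] and sell them when the
   gain first leaves the interval ]-k, 1[. *)
Definition trade_times p b h k (n : nat) w : \bar R :=
  match n with
  | 0 => hit_time p (fun x => `|x - b|) (cst 0) w
  | 1 => hit_time p (fun x => `|x - b|) (exit_gap b h k) w
  | _ => +oo%E
  end.

Definition positions h (n : nat) w : R := if n is 0 then h else 0.

Lemma gain_continuous b h : continuous (gain b h).
Proof.
by move=> x; apply: cvgMr; apply: cvgB; [exact: cvg_id | exact: cvg_cst].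
Qed.

Lemma distance_continuous b : continuous (fun x : R => `|x - b|).
Proof.
by move=> x; apply: cvg_norm; apply: cvgB; [exact: cvg_id | exact: cvg_cst].
Qed.

Lemma exit_gap_continuous b h k : continuous (exit_gap b h k).
Proof.
move=> x; apply: (@continuous_max _ _ (cst 0)
  (fun x => (gain b h x + k) * (1 - gain b h x))); first exact: cvg_cst.
have cg := @gain_continuous b h x.
by apply: cvgM; [apply: cvgD => //|apply: cvgB => //]; exact: cvg_cst.
Qed.

Lemma exit_gap_ge0 b h k x : 0 <= exit_gap b h k x.
Proof. by rewrite /exit_gap le_max lexx. Qed.

Lemma exit_gap_eq0 b h k x : 0 < k ->
  exit_gap b h k x = 0 <-> gain b h x <= - k \/ 1 <= gain b h x.
Proof.
rewrite /exit_gap; set y := gain b h x => k0; split=> [yE|yk].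
  have : (y + k) * (1 - y) <= 0 by rewrite -yE le_max lexx orbT.
  have [yk _|ky] := leP y (- k); first by left.
  by rewrite pmulr_rle0 ?subr_le0; [right | lra].
apply/max_l; case: yk => [yk|y1].
  by apply: mulr_le0_ge0; lra.
by apply: mulr_ge0_le0; lra.
Qed.

Lemma trade_times_stopping p b h k n : 0 <= p -> stopping_time (trade_times p b h k n).
Proof.
move=> p0; have cd := @distance_continuous b; case: n => [|[|n]] /=.
- by apply: hit_time_stopping => // x; exact: cvg_cst.
- apply: hit_time_stopping => //; first exact: exit_gap_continuous.
  exact: exit_gap_ge0.
- split=> [w|t t0]; first by rewrite leey.
  rewrite (_ : [set w | _] = set0); first exact: sigma_algebra0.
  by apply/seteqP; split=> w //=; rewrite leye_eq.
Qed.

Lemma trade_times_le p b h k n w :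
  (trade_times p b h k n w <= trade_times p b h k n.+1 w)%E.
Proof.
case: n => [|[|n]] /=; rewrite ?leey //.
by apply: first_time_ge => s [r [pr rs fr _]]; apply: first_time_lbound; exists r.
Qed.

Lemma trade_times_cvg p b h k w : trade_times p b h k n w @[n --> \oo] --> +oo%E.
Proof. by apply: cvg_near_cst; exists 2%N => // -[|[|n]]. Qed.

Lemma positions_bounded h n : exists C : R, forall w, `|positions h n w| <= C.
Proof. by exists `|positions h n point|; case: n. Qed.

(** The set is the whole space or empty. This serves the positions, which do not depend on the
    path. *)
Lemma stopped_sigma_algebra_cst (tau : cpath R -> \bar R) (P : Prop) :
  stopping_time tau -> stopped_sigma_algebra tau [set _ | P].
Proof.
move=> [_ stau]; have [pP|nP] := pselect P.
  rewrite (_ : [set _ | _] = setT); last by apply/seteqP; split.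
  split=> [|t t0]; last by rewrite setTI; exact: stau.
  by rewrite -(setD0 setT); apply: sigma_algebraCD; exact: sigma_algebra0.
rewrite (_ : [set _ | _] = set0); last by apply/seteqP; split.
by split=> [|t t0]; rewrite ?set0I; exact: sigma_algebra0.
Qed.

Lemma positions_measurable p b h k n (B : set R) : 0 <= p -> measurable B ->
  stopped_sigma_algebra (trade_times p b h k n) (positions h n @^-1` B).
Proof.
move=> p0 _; rewrite (_ : _ @^-1` B = [set _ | B (positions h n point)]).
  by apply: stopped_sigma_algebra_cst; exact: trade_times_stopping.
by case: n.
Qed.

Definition crossing_strategy p b h k (p0 : 0 <= p) : elementary_strategy R :=
  ElementaryStrategy (fun n => trade_times_stopping b h k n p0)
    (trade_times_le p b h k) (trade_times_cvg p b h k) (positions_bounded h)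
    (fun n B mB => @positions_measurable p b h k n B p0 mB).

Lemma crossing_capitalE p b h k (p0 : 0 <= p) c t w :
  elementary_capital (crossing_strategy b h k p0) c t w =
  c + h * (stopped_path (trade_times p b h k 1) t w -
           stopped_path (trade_times p b h k 0) t w).
Proof.
congr (c + _); apply: lim_near_cst => //; exists 1%N => // -[//|n] _.
rewrite /series /= big_nat_recl //= big1 ?addr0 // => i _.
by rewrite mul0r.
Qed.

(** The closed hit set contains [r], hence there is a visit [s <= r]; that visit is in the hit set
    too, so [r <= s]. *)
Lemma first_visit_value p b w r : 0 <= p ->
  hit_time p (fun x => `|x - b|) (cst 0) w = r%:E -> p <= r /\ w r = b.
Proof.
move=> p0 tauE; have cd := @distance_continuous b.
have [s [ps sr /normr0P /eqP ws _]] :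
    hit_set p (fun x => `|x - b|) (cst 0) w r.
  apply: first_time_mem => //; apply: closed_hit_set => // x; exact: cvg_cst.
have rs : (r%:E <= s%:E)%E.
  by rewrite -tauE; apply: first_time_lbound; exists s; rewrite ws normr0.
suff -> : r = s by split=> //; apply/eqP; rewrite -subr_eq0 ws.
by apply/le_anti; rewrite sr -lee_fin rs.
Qed.

Lemma stopped_path_ge (tau : cpath R -> \bar R) t w :
  (t%:E <= tau w)%E -> stopped_path tau t w = w t.
Proof. by move=> ttau; rewrite /stopped_path min_r. Qed.

Lemma stopped_path_le (tau : cpath R -> \bar R) r t w :
  tau w = r%:E -> r <= t -> stopped_path tau t w = w r.
Proof. by move=> tauE rt; rewrite /stopped_path tauE min_l // lee_fin. Qed.

Lemma crossing_capital0 p b h k (p0 : 0 <= p) c w :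
  elementary_capital (crossing_strategy b h k p0) c 0 w = c.
Proof.
have t0 n : (0 <= trade_times p b h k n w)%E.
  by have [] := trade_times_stopping b h k n p0.
by rewrite crossing_capitalE !stopped_path_ge // subrr mulr0 addr0.
Qed.

(* Until the exit time the gain cannot pass below [- k] without taking the
   value [- k], by the intermediate value theorem. *)
Lemma crossing_capital_ge0 p b h k (p0 : 0 <= p) t w : 0 < k -> 0 <= t ->
  0 <= elementary_capital (crossing_strategy b h k p0) k t w.
Proof.
move=> k0 t0; rewrite crossing_capitalE.
have := trade_times_le p b h k 0 w; have : (0 <= trade_times p b h k 0 w)%E.
  by have [] := trade_times_stopping b h k 0 p0.
set tau := trade_times p b h k 0; set sg := trade_times p b h k 1.
move=> tau0 tausg.
have [ttau|taut] := leP t%:E (tau w).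
  rewrite !stopped_path_ge ?(le_trans ttau) //.
  by rewrite subrr mulr0 addr0 ltW.
have [r tauE] : exists r, tau w = r%:E.
  by move: tau0 taut; case: (tau w) => // r _ _; exists r.
have rt : r <= t by rewrite -lee_fin -tauE ltW.
rewrite (stopped_path_le tauE rt); have [pr wr] := first_visit_value p0 tauE.
(* [s] is [t] while the units are held and the sale time afterwards. *)
have [s [rs ssg ->]] : exists s, [/\ r <= s, (s%:E <= sg w)%E &
    stopped_path sg t w = w s].
  have [tsg|/ltW sgt] := leP t%:E (sg w).
    by exists t; split=> //; exact: stopped_path_ge.
  move: tausg sgt; rewrite tauE; case E : (sg w) => [s| |] // rs st.
  by exists s; split=> //; apply: stopped_path_le.
rewrite wr -/(gain b h (w s)) -lerBlDl sub0r leNgt; apply/negP => ysk.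
have r0 : 0 <= r by exact: le_trans pr.
have yr : gain b h (w r) = 0 by rewrite /gain wr subrr mulr0.
have [||u /andP[ru us] yu] := @path_IVT _ _ w r s (- k) (@gain_continuous b h).
- by rewrite r0 rs.
- by rewrite yr ge_min le_max oppr_le0 (ltW k0) (ltW ysk) orbT.
have sgu : (sg w <= u%:E)%E.
  apply: first_time_lbound; exists r; split=> //; first by rewrite wr subrr normr0.
  by apply/exit_gap_eq0 => //; left; rewrite yu.
have su : s <= u by rewrite -lee_fin (le_trans ssg).
by move: ysk; rewrite (@le_anti _ _ s u) ?su // yu ltxx.
Qed.

(** The purchase happens at [u], the sale by time [v]. At the sale the gain is at most [- k] or at
    least 1, and its sign on [u, v] excludes the former. *)
Lemma crossing_capital_ge1 p b h k (p0 : 0 <= p) u v w : 0 < k ->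
  p <= u <= v -> w u = b -> (forall s, p <= s < u -> w s <> b) ->
  1 <= gain b h (w v) -> (forall s, u <= s <= v -> 0 <= gain b h (w s)) ->
  forall t, v <= t -> 1 <= elementary_capital (crossing_strategy b h k p0) k t w.
Proof.
move=> k0 /andP[pu uv] wu nob yv ypos t vt; rewrite crossing_capitalE.
set tau := trade_times p b h k 0; set sg := trade_times p b h k 1.
have wu0 : `|w u - b| = 0 by rewrite wu subrr normr0.
have tauE : tau w = u%:E.
  apply/le_anti/andP; split; first by apply: first_time_lbound; exists u.
  apply: first_time_ge => s [r [pr rs /eqP wr _]]; rewrite lee_fin (le_trans _ rs) //.
  rewrite leNgt; apply/negP => ru; apply: (nob r); rewrite ?pr //.
  by apply/eqP; rewrite -subr_eq0 -normr_eq0.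
have sgv : (sg w <= v%:E)%E.
  apply: first_time_lbound; exists u; split=> //.
  by apply/exit_gap_eq0 => //; right.
have [s sgE] : exists s, sg w = s%:E.
  have := trade_times_le p b h k 0 w; rewrite -/tau -/sg tauE.
  by move: sgv; case: (sg w) => // s _ _; exists s.
have us : u <= s by rewrite -lee_fin -tauE -sgE trade_times_le.
have sv : s <= v by rewrite -lee_fin -sgE.
have [_ [_ _ _ /(exit_gap_eq0 _ _ _ k0) ys]] :
    hit_set p (fun x => `|x - b|) (exit_gap b h k) w s.
  apply: first_time_mem => //; apply: closed_hit_set => //.
    exact: distance_continuous.
  exact: exit_gap_continuous.
rewrite (stopped_path_le tauE) ?(le_trans uv) //.
rewrite (stopped_path_le sgE) ?(le_trans sv) // wu -/(gain b h (w s)).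
by have := ypos s; rewrite us sv => /(_ isT) y0; case: ys => ys; lra.
Qed.

End CrossingStrategy.

(** * From isolated points to the upper bound *)

Lemma isolated_crossing (R : realType) (b : R) (w : cpath R) (t : R) :
    isolated (level_set w b) t ->
  exists (q h : rat) (v : R), [/\ `|ratr q| <= t <= v, w t = b,
    forall s, `|ratr q| <= s < t -> w s <> b, 1 <= gain b (ratr h) (w v)
    & forall s, t <= s <= v -> 0 <= gain b (ratr h) (w s)].
Proof.
move=> [/set_mem[/= t0 wt] [V /nbhs_ballP[d /= d0 dV] VE]].
have iso s : 0 <= s -> `|t - s| < d -> w s = b -> s = t.
  move=> s0 std ws; have : (V `&` level_set w b) s by split=> //; exact: dV.
  by rewrite VE.
(* The absolute value makes every rational an admissible starting time; [q = 0] handles [t = 0]. *)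
have [q [qt qd]] : exists q : rat, `|ratr q| <= t /\ t - d < `|ratr q|.
  have [tE|tn0] := eqVneq t 0.
    by exists 0; rewrite rmorph0 normr0; split; lra.
  have [|q] := @rat_in_itvoo R (Num.max 0 (t - d)) t.
    by rewrite gt_max lt_neqAle eq_sym tn0 t0 /=; lra.
  rewrite in_itv /= gt_max => /andP[/andP[q0 qd] qt].
  by exists q; rewrite ger0_norm ltW.
pose v := t + d / 2; have tv : t <= v by rewrite /v; lra.
have D0 : w v - b != 0.
  rewrite subr_eq0; apply/eqP => /iso vt.
  suff : v = t by rewrite /v; lra.
  by apply: vt; [exact: le_trans tv | rewrite /v ltr0_norm; lra].
(* The slope [2 / (w v - b)] would give gain 2 at [v]; a rational close to it keeps the gain above
   1. *)
have [h hD] : exists h : rat, 1 < ratr h * (w v - b).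
  apply: (@rat_approx _ (fun x => 1 < x * (w v - b)) (2 / (w v - b))).
  by apply: (cvgr_gt _ (cvgMl cvg_id)); rewrite divfK //; lra.
exists q, h, v; split=> //; first by rewrite qt.
- move=> s /andP[qs st] /iso sE.
  by move: (st); rewrite sE ?ltxx ?(le_trans _ qs) // ger0_norm; lra.
- exact: ltW.
move=> s /andP[ts sv]; rewrite leNgt; apply/negP => ys.
have s0 : 0 <= s by exact: le_trans ts.
(* A negative gain at [s] would force a visit to [b] in [s, v]. Isolation makes it [t], so [s = t],
   where the gain is 0. *)
have [||u /andP[su uv] /eqP] :=
    @path_IVT _ _ w s v 0 (@gain_continuous _ b (ratr h)).
- by rewrite s0 sv.
- by rewrite ge_min (ltW ys) /= le_max (le_trans _ (ltW hD)) ?orbT.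
rewrite /gain mulf_eq0 => /orP[/eqP h0|]; first by move: hD; rewrite h0; lra.
rewrite subr_eq0 => /eqP /iso ut.
have {}ut : u = t.
  by apply: ut; [exact: le_trans su |
    rewrite ler0_norm; move: uv; rewrite /v; lra].
have st : s = t by apply/le_anti; rewrite ts -ut su.
by move: ys; rewrite st /gain wt subrr mulr0 ltxx.
Qed.

Lemma limf_einf_ge (R : realType) (u : R -> \bar R) (T : R) (x : \bar R) :
  (forall t, T <= t -> (x <= u t)%E) -> (x <= limf_einf u (pinfty_nbhs R))%E.
Proof.
move=> xu; rewrite limf_einfE.
apply: (@le_trans _ _ (ereal_inf (u @` [set t | T <= t]))).
  by apply: le_ereal_inf_tmp => _ [t Tt <-]; exact: xu.
apply: ereal_sup_ubound; exists [set t | T <= t] => //.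
exact: (nbhs_pinfty_ge (num_real T)).
Qed.

Lemma upper_probability_ge0 (R : realType) (E : set (cpath R)) :
  (0 <= upper_probability E)%E.
Proof.
apply: le_ereal_inf_tmp => x [S [[G [c [pos _ SE]]] S0 _]].
rewrite -(S0 point) SE //; apply: nneseries_ge0 => n _ _.
by rewrite lee_fin pos.
Qed.

Theorem theorem1 (R : realType) (b : R) :
  almost_surely (fun w : cpath R =>
    ~ exists t : R, isolated (level_set w b) t).
Proof.
apply/le_anti; rewrite upper_probability_ge0 andbT.
apply/lee_addgt0Pr => e e0; rewrite add0e.
pose c n : R := e / (2 ^ n.+1)%:R.
have c0 n : 0 < c n by rewrite divr_gt0 // ltr0n expn_gt0.
(* Numbers that code no pair get (0, 0); their strategies still have nonnegative capital. *)
pose idx n : rat * rat := odflt (0, 0) (unpickle n).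
pose G n := crossing_strategy b (ratr (idx n).2) (c n)
  (normr_ge0 (ratr (idx n).1 : R)).
pose S (t : R) w := (\sum_(0 <= n <oo) (elementary_capital (G n) (c n) t w)%:E)%E.
have pos n t w : 0 <= t -> 0 <= elementary_capital (G n) (c n) t w.
  by move=> t0; exact: crossing_capital_ge0.
have S0 w : S 0 w = (\sum_(0 <= n <oo) (c n)%:E)%E.
  by apply: eq_eseriesr => n _; rewrite crossing_capital0.
apply: ge_ereal_inf; exists (S 0 point); last first.
  by rewrite S0; apply: (@epsilon_trick0 R e xpredT); exact: ltW.
exists S; split=> [|w|w]; last 2 first.
- by rewrite !S0.
(* The double negation arises because the exceptional set negates a property that is itself a
   negation. *)
- have [wE|wE] := pselect (~ ~ exists t : R, isolated (level_set w b) t); last first.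
    rewrite indicE memNset //; apply: (@limf_einf_ge _ _ 0) => t t0.
    by apply: nneseries_ge0 => n _ _; rewrite lee_fin pos.
  rewrite indicE mem_set //.
  have [t /isolated_crossing[q [h [v [qtv wt nob yv ypos]]]]] :=
    contrapT wE.
  apply: (@limf_einf_ge _ _ v) => s vs.
  have s0 : 0 <= s.
    case/andP: qtv => qt tv.
    by rewrite (le_trans _ vs) // (le_trans _ tv) // (le_trans _ qt).
  pose n := pickle (q, h).
  (* From time [v] on, the strategy coded by (q, h) alone holds at least 1; all others contribute
     nonnegative amounts. *)
  apply: (@le_trans _ _ (elementary_capital (G n) (c n) s w)%:E).
    rewrite lee_fin; apply: (@crossing_capital_ge1 _ _ _ _ _ _ t v) => //;
      by rewrite /idx /n pickleK.
  have Sn : (\sum_(0 <= i < n.+1) (elementary_capital (G i) (c i) s w)%:E <= S s w)%E.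
    by apply: nneseries_lim_ge => i _ _; rewrite lee_fin pos.
  apply: le_trans Sn; rewrite big_nat_recr //= leeDr //.
  by apply: sume_ge0 => i _; rewrite lee_fin pos.
exists G, c; split=> //.
have -> : c = fun n => e / (2 ^ (n + 1))%:R by apply/funext => n; rewrite addn1.
exact/cvgP/(cvg_geometric_series_half e 0).
Qed.
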